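(* Let $H$ be a complex Hilbert space and let $(\alpha_1,\dots,\alpha_n)$ be an $n$-tuple of linearly independent vectors in $H$. Let $G=(\langle\alpha_i,\alpha_j\rangle)_{i,j=1}^n\in M_n(\mathbb C)$ be the matrix with $(i,j)$ entry $\langle\alpha_i,\alpha_j\rangle$, and let $G^T$ be its transpose, with $(i,j)$ entry $\langle\alpha_j,\alpha_i\rangle$. Then: (1) For any orthonormal basis $(\beta_1,\dots,\beta_n)$ of $\operatorname{span}\{\alpha_1,\dots,\alpha_n\}$ there exists an invertible matrix $A=(a_{ij})\in M_n(\mathbb C)$ such that $\beta_i=\sum_{j=1}^n a_{ij}\alpha_j$ for $i=1,\dots,n$, and $$\sum_{i=1}^n\|\beta_i-\alpha_i\|^2=n+\sum_{i=1}^n\|\alpha_i\|^2-2\operatorname{Re}\big(\operatorname{tr}(G^T A^T)\big).$$ (2) The matrix $G^T$ is positive definite (hence so is $G$). Define $(\epsilon_1,\dots,\epsilon_n)$ by $\epsilon_i=\sum_{j=1}^n (G^{-1/2})_{ij}\,\alpha_j$ for $i=1,\dots,n$. Then: (a) $(\epsilon_1,\dots,\epsilon_n)$ is an orthonormal basis of $\operatorname{span}\{\alpha_1,\dots,\alpha_n\}$. (b) $$\sum_{i=1}^n\|\epsilon_i-\alpha_i\|^2=n+\sum_{i=1}^n\|\alpha_i\|^2-2\operatorname{tr}\big((G^T)^{1/2}\big).$$ (c) For any orthonormal basis $(\beta_1,\dots,\beta_n)$ of $\operatorname{span}\{\alpha_1,\dots,\alpha_n\}$, $$\sum_{i=1}^n\|\epsilon_i-\alpha_i\|^2\le\sum_{i=1}^n\|\beta_i-\alpha_i\|^2,$$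 and equality holds if and only if $(\beta_1,\dots,\beta_n)=(\epsilon_1,\dots,\epsilon_n)$.
   Context: The inner product $\langle\cdot,\cdot\rangle$ is linear in the first variable and conjugate-linear in the second. Orthonormal bases are ordered $n$-tuples. For a positive definite matrix $G$, $G^{1/2}$ denotes its positive definite square root and $G^{-1/2}=(G^{1/2})^{-1}$. $A^T$ is the transpose (without conjugation) and $\operatorname{tr}$ is the usual (unnormalized) trace. *)

(* Defs.v *)
From HB Require Import structures.
From mathcomp Require Import all_boot all_order all_algebra.
From mathcomp Require Import all_classical all_reals all_analysis.
Set Implicit Arguments.
Unset Strict Implicit.
Unset Printing Implicit Defensive.
Import Order.TTheory GRing.Theory Num.Theory.
Local Open Scope classical_set_scope.
Local Open Scope ring_scope.
Local Open Scope sesquilinear_scope.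

Definition lin_independent (K : nzRingType) (V : lmodType K) (n : nat)
    (a : n.-tuple V) :=
  forall c : 'I_n -> K, \sum_(i < n) c i *: tnth a i = 0 -> forall i, c i = 0.

Definition lin_span (K : nzRingType) (V : lmodType K) (n : nat)
    (a : n.-tuple V) : set V :=
  [set x | exists c : 'I_n -> K, x = \sum_(i < n) c i *: tnth a i].

Definition orthonormal_basis (C : numClosedFieldType) (V : lmodType C)
    (ip : {dot V for @Num.conj C}) (W : set V) (n : nat) (b : n.-tuple V) :=
  orthonormal ip b /\ lin_span b = W.

Definition posdefmx (C : numClosedFieldType) (n : nat) (M : 'M[C]_n) :=
  M \is hermsymmx /\
  forall v : 'rV[C]_n, v != 0 -> 0 < (v *m M *m v ^t*) 0 0.

(* By [sqrtmx_posdef], [sqrtmxK] and [sqrtmx_uniq], if [M] is positive definite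
   then this is its unique positive definite square root. *)
Definition sqrtmx (C : numClosedFieldType) (n : nat) (M : 'M[C]_n) : 'M[C]_n :=
  xget 0 [set S | posdefmx S /\ S *m S = M].

Section SqrtMx.
Variables (C : numClosedFieldType) (n : nat).
Implicit Types M S T : 'M[C]_n.

Let hermP M : M \is hermsymmx <-> M ^t* = M.
Proof.
split=> [/is_hermitianmxP|h]; first by rewrite expr0 scale1r => <-.
by apply/is_hermitianmxP; rewrite expr0 scale1r h.
Qed.

Let trC_mul (m p q : nat) (A : 'M[C]_(m, p)) (B : 'M[C]_(p, q)) :
  (A *m B) ^t* = B ^t* *m A ^t*.
Proof. by rewrite trmx_mul map_mxM. Qed.

Let row_spectral_neq0 M i : row i (spectralmx M) != 0.
Proof.
apply/eqP => h; have /unitarymxP/(congr1 (row i)) := spectral_unitarymx M.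
rewrite row_mul h mul0mx => /rowP/(_ i).
by rewrite !mxE eqxx => /esym/eqP; rewrite oner_eq0.
Qed.

Let row_spectral M i : M \is hermsymmx ->
  row i (spectralmx M) *m M = spectral_diag M 0 i *: row i (spectralmx M).
Proof.
move=> /hermitian_normalmx /orthomx_spectralP {2}->.
rewrite -row_mul !mulmxA mulmxV ?spectral_unit// mul1mx row_mul row_diag_mx.
by rewrite -scalemxAl -rowE.
Qed.

Lemma posdefmx_sqrt_exists M :
  posdefmx M -> exists S, posdefmx S /\ S *m S = M.
Proof.
move=> [Mh Mpos]; set P := spectralmx M; set d := spectral_diag M.
have PU : P *m P ^t* = 1%:M by apply/unitarymxP/spectral_unitarymx.
have MP : M = P ^t* *m diag_mx d *m P.
  rewrite -[P ^t*]invmx_unitary ?spectral_unitarymx//.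
  exact/orthomx_spectralP/hermitian_normalmx.
have d_gt0 i : 0 < d 0 i.
  have := Mpos _ (row_spectral_neq0 M i).
  rewrite row_spectral// -scalemxAl mxE -/P -/d.
  suff -> : (row i P *m row i P ^t*) 0 0 = 1 by rewrite mulr1.
  have /matrixP/(_ i i) := PU; rewrite [in RHS]mxE eqxx mulr1n => <-.
  by rewrite !mxE; apply: eq_bigr => k _; rewrite !mxE.
pose s : 'rV[C]_n := \row_i sqrtC (d 0 i).
have s_gt0 i : 0 < s 0 i by rewrite mxE sqrtC_gt0.
have ss : diag_mx s *m diag_mx s = diag_mx d.
  rewrite mulmx_diag; congr diag_mx; apply/rowP => i.
  by rewrite !mxE -expr2 sqrtCK.
exists (P ^t* *m diag_mx s *m P); split; last first.
  by rewrite !mulmxA -[_ *m P *m P ^t*]mulmxA PU mulmx1 MP -ss !mulmxA.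
split.
  apply/hermP; rewrite !trC_mul trmxCK mulmxA; congr (_ *m _ *m _).
  rewrite tr_diag_mx map_diag_mx; congr diag_mx; apply/rowP => i.
  by rewrite [LHS]mxE; apply/CrealP/ger0_real/ltW.
move=> v v0; pose w := v *m P ^t*.
have w0 : w != 0.
  apply: contra v0 => /eqP w0; apply/eqP.
  by rewrite -[v]mulmx1 -(mulmx1C PU) mulmxA -/w w0 mul0mx.
rewrite (_ : v *m _ *m _ = w *m diag_mx s *m w ^t*); last first.
  by rewrite /w trC_mul trmxCK !mulmxA.
have term j : (w *m diag_mx s) 0 j * (w ^t*) j 0 = s 0 j * (w 0 j * (w 0 j)^*).
  by rewrite mul_mx_diag !mxE mulrCA mulrA.
have [j wj0] := rV0Pn _ w0.
rewrite mxE (bigD1 j)//= term ltr_wpDr//; last first.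
  by rewrite mulr_gt0// mul_conjC_gt0.
apply: sumr_ge0 => k _; rewrite term.
by rewrite mulr_ge0 ?mul_conjC_ge0// ltW.
Qed.

Lemma posdefmx_sqrt_unique S T :
  posdefmx S -> posdefmx T -> S *m S = T *m T -> S = T.
Proof.
move=> [Sh Spos] [Th Tpos] ST; apply/eqP; rewrite -subr_eq0; apply/eqP.
set D := S - T.
have Dh : D \is hermsymmx.
  apply/hermP; rewrite /D linearB/= map_mxB.
  by have [/hermP -> /hermP ->] := (Sh, Th).
have DE : S *m D + D *m T = 0.
  by rewrite /D mulmxBr mulmxBl ST addrA subrK subrr.
have d0 i : spectral_diag D 0 i = 0.
  set v := row i (spectralmx D); set l := spectral_diag D 0 i.
  have v0 : v != 0 := row_spectral_neq0 D i.
  have vD : v *m D = l *: v := row_spectral i Dh.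
  have lR : l^* = l.
    by apply/CrealP; exact: (mxOverP (hermitian_spectral_diag_real Dh)).
  have Dv : D *m v ^t* = l *: v ^t*.
    have /hermP {1}<- := Dh; rewrite -trC_mul vD.
    by rewrite linearZ/= map_mxZ/= lR.
  have : (v *m (S *m D + D *m T) *m v ^t*) 0 0 = 0.
    by rewrite DE mulmx0 mul0mx mxE.
  rewrite mulmxDr mulmxDl !mulmxA -[_ *m D *m v ^t*]mulmxA Dv vD.
  rewrite -scalemxAr -!scalemxAl -scalerDr mxE => /eqP.
  rewrite mulf_eq0 => /orP[/eqP//|]; rewrite mxE.
  by rewrite gt_eqF// addr_gt0// ?Spos ?Tpos.
have /hermitian_normalmx /orthomx_spectralP -> := Dh.
rewrite (_ : spectral_diag D = 0); first by rewrite linear0 mulmx0 mul0mx.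
by apply/rowP => i; rewrite d0 mxE.
Qed.

Let sqrtmxP M S : posdefmx S -> S *m S = M ->
  posdefmx (sqrtmx M) /\ sqrtmx M *m sqrtmx M = M.
Proof.
move=> Sp SM.
exact: (@xgetI _ 0 [set S | posdefmx S /\ S *m S = M] S (conj Sp SM)).
Qed.

Lemma sqrtmx_posdef M : posdefmx M -> posdefmx (sqrtmx M).
Proof. by move=> /posdefmx_sqrt_exists [S [Sp]] /(sqrtmxP Sp) []. Qed.

Lemma sqrtmxK M : posdefmx M -> sqrtmx M *m sqrtmx M = M.
Proof. by move=> /posdefmx_sqrt_exists [S [Sp]] /(sqrtmxP Sp) []. Qed.

Lemma sqrtmx_uniq M S : posdefmx S -> S *m S = M -> S = sqrtmx M.
Proof.
move=> Sp SM; have [Tp TM] := sqrtmxP Sp SM.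
by apply: posdefmx_sqrt_unique => //; rewrite SM.
Qed.

End SqrtMx.

(* Main.v *)
Require Import Defs.
From mathcomp Require Import all_boot all_order all_algebra.
From mathcomp Require Import complex.
From mathcomp Require Import all_classical all_reals all_analysis.
Set Implicit Arguments.
Unset Strict Implicit.
Unset Printing Implicit Defensive.
Import Order.TTheory GRing.Theory Num.Theory.
Import numFieldNormedType.Exports.
Local Open Scope ring_scope.

(** Let [S] be the positive square root of [G].  A tuple [b] in the span of [a]
    with coefficient matrix [B] has Gram matrix [B G B^*], so it is orthonormal
    iff [U = B S] is unitary; the tuple [e] is the case [U = 1].  The cross term
    of the distance is [tr (B G) = tr (U S)], and since
    [tr ((U - 1) S (U - 1)^* ) = 2 (tr S - Re tr (U S))], the distance from [b]
    to [a] exceeds that from [e] to [a] by the trace of [(U - 1) S (U - 1)^*],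
    which is nonnegative and vanishes only for [U = 1]. *)

(** * Transposes, congruences and traces of positive definite matrices *)

Section PositiveDefinite.
Local Open Scope sesquilinear_scope.
Variables (C : numClosedFieldType) (n : nat).
Implicit Types M D U : 'M[C]_n.

Lemma hermsymmxP M : M \is hermsymmx <-> M ^t* = M.
Proof.
split=> [/is_hermitianmxP|h]; first by rewrite expr0 scale1r => <-.
by apply/is_hermitianmxP; rewrite expr0 scale1r h.
Qed.

Lemma trmxC_mul (m p q : nat) (A : 'M[C]_(m, p)) (B : 'M[C]_(p, q)) :
  (A *m B) ^t* = B ^t* *m A ^t*.
Proof. by rewrite trmx_mul map_mxM. Qed.

Lemma posdefmx_unit M : posdefmx M -> M \in unitmx.
Proof.
move=> [_ Mpos]; rewrite -row_free_unit; apply: inj_row_free => v vM.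
apply/eqP; apply: contraT => /Mpos.
by rewrite vM mul0mx mxE ltxx.
Qed.

Lemma posdefmx_tr M : posdefmx M -> posdefmx M^T.
Proof.
move=> [/hermsymmxP Mh Mpos]; split.
  by apply/hermsymmxP; rewrite -[in RHS]Mh [in RHS]map_trmx.
(* The form of [M^T] at [v] is the form of [M] at the entrywise conjugate of [v]: the two 1 by 1
   products are transposes of each other. *)
move=> v v0; have w0 : v ^ Num.conj != 0.
  by rewrite -(map_mx0 Num.conj); apply: contra v0 => /eqP/map_mx_inj ->.
have := Mpos _ w0; rewrite (_ : (_ *m _) = (v *m M^T *m v ^t*)^T) ?mxE//.
rewrite !trmx_mul !trmxK mulmxA; congr (_ *m _ *m _).
  by rewrite map_trmx trmxK.
by apply/matrixP => i j; rewrite !mxE conjCK.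
Qed.

(** The transpose of the root is again positive definite and squares to [M^T], so uniqueness of the
    root applies. *)
Lemma sqrtmx_tr M : posdefmx M -> sqrtmx M^T = (sqrtmx M)^T.
Proof.
move=> Mp; apply/esym/sqrtmx_uniq; first exact/posdefmx_tr/sqrtmx_posdef.
by rewrite -trmx_mul sqrtmxK.
Qed.

(** The diagonal entry is the quadratic form of [M] at the [i]-th row of [D]. *)
Lemma posdefmx_congr_diag_ge0 M D i : posdefmx M ->
  0 <= (D *m M *m D ^t*) i i ?= iff (row i D == 0).
Proof.
move=> [_ Mpos].
have -> : (D *m M *m D ^t*) i i = (row i D *m M *m (row i D) ^t*) 0 0.
  rewrite -row_mul !mxE.
  by apply: eq_bigr => k _; rewrite !mxE.
have [->|/Mpos h] := eqVneq (row i D) 0.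
  by split; rewrite !mul0mx mxE ?eqxx.
by split; rewrite ?ltW// lt_eqF.
Qed.

(** A vanishing sum of nonnegative diagonal entries kills every row of [D]. This equality case later
    yields uniqueness of the closest basis. *)
Lemma posdefmx_congr_trace_ge0 M D : posdefmx M ->
  0 <= \tr (D *m M *m D ^t*) ?= iff (D == 0).
Proof.
move=> Mp; have h i := posdefmx_congr_diag_ge0 D i Mp.
split; first by apply: sumr_ge0 => i _; rewrite (h i).
apply/eqP/eqP => [/esym t0|->]; last by rewrite !mul0mx mxtrace0.
apply/row_matrixP => i; rewrite row0; apply/eqP; rewrite -(h i) eq_sym.
by move: t0 => /psumr_eq0P -> // k _; rewrite (h k).
Qed.

(** Expand the product: by cyclicity [U M U^*] has trace [tr M], and the cross terms [U M] and
    [M U^*] are adjoint to each other, so their traces are conjugate. *)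
Lemma unitary_congr_sub1_trace M U : M ^t* = M -> U *m U ^t* = 1%:M ->
  \tr ((U - 1%:M) *m M *m (U - 1%:M) ^t*) = 2 * (\tr M - 'Re (\tr (U *m M))).
Proof.
move=> Mh UU; rewrite linearB/= map_mxB trmx1 map_mx1.
rewrite !(mulmxBl, mulmxBr) !mul1mx !mulmx1.
rewrite !linearB/= [\tr (U *m M *m _)]mxtrace_mulC mulmxA (mulmx1C UU) mul1mx.
have -> : \tr (M *m U ^t*) = (\tr (U *m M))^*.
  by rewrite -{1}Mh -trmxC_mul trace_map_mx mxtrace_tr.
rewrite ReE; set x := \tr M; set y := \tr _.
rewrite mulrBr mulrCA divff ?pnatr_eq0// mulr1 mulr_natl mulr2n.
by rewrite !opprD !opprK !addrA addrAC [x - _ + x]addrAC [LHS]addrAC.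
Qed.

End PositiveDefinite.

(** * Gram matrices and coefficient matrices of tuples *)

Section Gram.
Local Open Scope sesquilinear_scope.
Variables (C : numClosedFieldType) (V : lmodType C).
Variables (ip : {dot V for @Num.conj C}) (n : nat).
Implicit Types (a b x y : n.-tuple V) (A B : 'M[C]_n).

Definition gram x y : 'M[C]_n := \matrix_(i, j) ip (tnth x i) (tnth y j).

Definition lcomb B a : n.-tuple V := [tuple \sum_(j < n) B i j *: tnth a j | i < n].

Lemma tnth_lcomb B a i : tnth (lcomb B a) i = \sum_(j < n) B i j *: tnth a j.
Proof. by rewrite tnth_mktuple. Qed.

Lemma dotC (u v : V) : ip u v = (ip v u)^*.
Proof. by rewrite hermC expr0 mul1r. Qed.

Lemma gram_tC x y : (gram x y) ^t* = gram y x.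
Proof. by apply/matrixP => i j; rewrite !mxE -dotC. Qed.

Lemma gram_lcombl B a x : gram (lcomb B a) x = B *m gram a x.
Proof.
apply/matrixP => i k; rewrite !mxE tnth_lcomb linear_sumlz.
by apply: eq_bigr => j _; rewrite !mxE linearZl_LR.
Qed.

Lemma gram_lcombr B a x : gram x (lcomb B a) = gram x a *m B ^t*.
Proof. by rewrite -gram_tC gram_lcombl trmxC_mul gram_tC. Qed.

Lemma lcombM A B a : lcomb A (lcomb B a) = lcomb (A *m B) a.
Proof.
apply: eq_from_tnth => i; rewrite !tnth_lcomb.
under eq_bigr do rewrite tnth_lcomb scaler_sumr.
rewrite exchange_big/=; apply: eq_bigr => j _; rewrite mxE scaler_suml.
by apply: eq_bigr => k _; rewrite scalerA.
Qed.

Lemma lcomb1 a : lcomb 1%:M a = a.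
Proof.
apply: eq_from_tnth => i; rewrite tnth_lcomb (bigD1 i)//= mxE eqxx scale1r.
by rewrite big1 ?addr0// => j /negPf ji; rewrite mxE eq_sym ji scale0r.
Qed.

Lemma lin_span_sub B a (x : V) : lin_span (lcomb B a) x -> lin_span a x.
Proof.
move=> [c ->]; exists (fun j => \sum_(i < n) c i * B i j).
under eq_bigr do rewrite tnth_lcomb scaler_sumr.
rewrite exchange_big/=; apply: eq_bigr => j _; rewrite scaler_suml.
by apply: eq_bigr => i _; rewrite scalerA.
Qed.

Lemma lin_span_lcomb B a : B \in unitmx -> lin_span (lcomb B a) = lin_span a.
Proof.
move=> Bu; apply/seteqP; split=> x; first exact: lin_span_sub.
(* The tuple [a] is recovered from [lcomb B a] with coefficients [invmx B], so the inclusion just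
   proved also runs backwards. *)
by rewrite -{1}(lcomb1 a) -(mulVmx Bu) -lcombM; exact: lin_span_sub.
Qed.

Lemma mem_lin_span a i : lin_span a (tnth a i).
Proof. by exists ((1%:M : 'M[C]_n) i); rewrite -tnth_lcomb lcomb1. Qed.

Lemma lin_span_eq_lcomb a b : lin_span b = lin_span a -> exists B, b = lcomb B a.
Proof.
move=> ba; have h i : exists c : 'I_n -> C, tnth b i = \sum_(j < n) c j *: tnth a j.
  by have := mem_lin_span b i; rewrite ba.
have [c cE] := choice h; exists (\matrix_(i, j) c i j).
apply: eq_from_tnth => i; rewrite tnth_lcomb cE.
by apply: eq_bigr => j _; rewrite mxE.
Qed.

Lemma orthonormal_gramP b : orthonormal ip b <-> gram b b = 1%:M.
Proof.
split=> [/orthonormalP[ub ob]|g1].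
  apply/matrixP => i j; rewrite !mxE ob ?mem_tnth//.
  by rewrite !(tnth_nth 0) nth_uniq ?size_tuple.
have bE i j : ip (tnth b i) (tnth b j) = (i == j)%:R.
  by have /matrixP/(_ i j) := g1; rewrite !mxE.
(* A repeated vector would have inner product with itself equal to both 1 and 0. *)
have b_inj : injective (tnth b).
  move=> i j bij; apply/eqP; have := bE i j.
  rewrite bij bE eqxx; case: (i == j) => // /eqP.
  by rewrite oner_eq0.
apply/orthonormalP; split; first exact/tuple_uniqP.
by move=> _ _ /tnthP[i ->] /tnthP[j ->]; rewrite bE (inj_eq b_inj).
Qed.

(** The quadratic form at [v] is the squared norm of the combination of [a] with coefficients [v],
    which independence keeps nonzero. *)
Lemma gram_posdef a : lin_independent a -> posdefmx (gram a a).
Proof.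
move=> a_indep; split; first by apply/hermsymmxP; rewrite gram_tC.
move=> v v0; pose x := \sum_(i < n) v 0 i *: tnth a i.
have -> : (v *m gram a a *m v ^t*) 0 0 = ip x x.
  rewrite /x linear_sumr mxE; apply: eq_bigr => j _.
  rewrite linearZr_LR/= mulrC !mxE linear_sumlz; congr (_ * _).
  by apply: eq_bigr => i _; rewrite linearZl_LR mxE.
rewrite dnorm_gt0; apply: contra v0 => /eqP /a_indep h.
by apply/eqP/rowP => i; rewrite h mxE.
Qed.

Lemma sum_dnormB a b :
  \sum_(i < n) ip (tnth b i - tnth a i) (tnth b i - tnth a i) =
  \tr (gram b b) + \tr (gram a a) - 2 * 'Re (\tr (gram b a)).
Proof.
rewrite ReE mulrCA divff ?pnatr_eq0// mulr1 -trace_map_mx -!raddfD -raddfB/=.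
by apply: eq_bigr => i _; rewrite dnormB !mxE.
Qed.

Lemma orthonormal_sum_dnormB a B : orthonormal ip (lcomb B a) ->
  \sum_(i < n) ip (tnth (lcomb B a) i - tnth a i) (tnth (lcomb B a) i - tnth a i) =
  n%:R + \tr (gram a a) - 2 * 'Re (\tr (B *m gram a a)).
Proof.
by move=> /orthonormal_gramP g1; rewrite sum_dnormB g1 gram_lcombl mxtrace1.
Qed.

Lemma orthonormal_basis_lcomb a b : orthonormal_basis ip (lin_span a) b ->
  exists B, [/\ B \in unitmx, b = lcomb B a & B *m gram a a *m B ^t* = 1%:M].
Proof.
move=> [/orthonormal_gramP g1 /lin_span_eq_lcomb[B bE]]; exists B.
move: g1; rewrite bE gram_lcombl gram_lcombr mulmxA => g1; split=> //.
(* The Gram identity exhibits [G B^*] as a right inverse of the square matrix [B]. *)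
by move: g1; rewrite -mulmxA => /mulmx1_unit[].
Qed.

(** Löwdin's symmetric orthonormalization of [a]. *)
Definition loewdin a := lcomb (invmx (sqrtmx (gram a a))) a.

(** * Orthonormality and optimality of the symmetric orthonormalization *)

Section Loewdin.
Variables (a : n.-tuple V) (a_indep : lin_independent a).
Let G := gram a a.
Let S := sqrtmx G.
Let Gp : posdefmx G := gram_posdef a_indep.
Let Sp : posdefmx S := sqrtmx_posdef Gp.
Let SS : S *m S = G := sqrtmxK Gp.
Let Su : S \in unitmx := posdefmx_unit Sp.
Let Sh : S ^t* = S := (hermsymmxP S).1 Sp.1.

Lemma loewdin_onb : orthonormal_basis ip (lin_span a) (loewdin a).
Proof.
split; last by rewrite lin_span_lcomb ?unitmx_inv.
apply/orthonormal_gramP; rewrite gram_lcombl gram_lcombr -/G -/S -SS.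
rewrite !mulmxA mulVmx// mul1mx -[X in X *m _]Sh -trmxC_mul mulVmx//.
by rewrite trmx1 map_mx1.
Qed.

Lemma loewdin_dist :
  \sum_(i < n) ip (tnth (loewdin a) i - tnth a i) (tnth (loewdin a) i - tnth a i) =
  n%:R + \tr G - 2 * \tr S.
Proof.
rewrite orthonormal_sum_dnormB; last by have [] := loewdin_onb.
rewrite -/G -/S -SS mulmxA mulVmx// mul1mx; congr (_ - 2 * _).
(* The cross term is now [tr S], which is real because [S] is Hermitian. *)
by apply/Creal_ReP/CrealP; rewrite -[in RHS]Sh trace_map_mx mxtrace_tr.
Qed.

Lemma loewdin_best b : orthonormal_basis ip (lin_span a) b ->
  \sum_(i < n) ip (tnth (loewdin a) i - tnth a i) (tnth (loewdin a) i - tnth a i) <=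
  \sum_(i < n) ip (tnth b i - tnth a i) (tnth b i - tnth a i)
  ?= iff (b == loewdin a).
Proof.
move=> b_onb; have [B [Bu bE BG]] := orthonormal_basis_lcomb b_onb.
have ob : orthonormal ip (lcomb B a) by rewrite -bE; case: b_onb.
pose U := B *m S.
have UU : U *m U ^t* = 1%:M.
  by rewrite trmxC_mul Sh mulmxA -[U *m S]mulmxA SS.
have -> : (b == loewdin a) = (U - 1%:M == 0).
  rewrite subr_eq0; apply/eqP/eqP => [bl|U1]; last first.
    by rewrite bE -[B](mulmxK Su) -/U U1 mul1mx.
  (* Equal tuples have equal coefficient matrices: pair both with [a] and cancel the invertible
     [G]. *)
  have : gram b a = gram (loewdin a) a by rewrite bl.
  rewrite bE !gram_lcombl -/G -/S => /(can_inj (mulmxK (posdefmx_unit Gp))).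
  by rewrite /U => ->; rewrite mulVmx.
have [tge teq] := posdefmx_congr_trace_ge0 (U - 1%:M) Sp.
rewrite loewdin_dist bE (orthonormal_sum_dnormB ob) -/G.
(* Since [U S = B G], the trace is twice the gap between [tr S] and the real cross term of [b], that
   is, the difference of the two distances. *)
move: tge teq; rewrite unitary_congr_sub1_trace// /U -mulmxA SS => tge teq.
split; first by rewrite lerD2l lerN2 -subr_ge0 -mulrBr.
by rewrite (inj_eq (addrI _)) eqr_opp -subr_eq0 -mulrBr eq_sym.
Qed.

End Loewdin.
End Gram.

Theorem theorem2p1 (R : realType) (H : completeNormedModType R[i])
    (ip : {dot H for @Num.conj R[i]})
    (ip_norm : forall x : H, `|x| ^+ 2 = ip x x)
    (n : nat) (a : n.-tuple H) (a_indep : lin_independent a) :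
  let G : 'M[R[i]]_n := \matrix_(i, j) ip (tnth a i) (tnth a j) in
  let e : n.-tuple H :=
    [tuple \sum_(j < n) (invmx (sqrtmx G)) i j *: tnth a j | i < n] in
  (forall b : n.-tuple H, orthonormal_basis ip (lin_span a) b ->
     exists A : 'M[R[i]]_n,
       [/\ A \in unitmx,
           forall i, tnth b i = \sum_(j < n) A i j *: tnth a j
         & \sum_(i < n) `|tnth b i - tnth a i| ^+ 2 =
           n%:R + \sum_(i < n) `|tnth a i| ^+ 2 - 2 * 'Re (\tr (G^T *m A^T))]) /\
  [/\ posdefmx G^T,
      posdefmx G,
      orthonormal_basis ip (lin_span a) e,
      \sum_(i < n) `|tnth e i - tnth a i| ^+ 2 =
        n%:R + \sum_(i < n) `|tnth a i| ^+ 2 - 2 * \tr (sqrtmx G^T)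
    & forall b : n.-tuple H, orthonormal_basis ip (lin_span a) b ->
        \sum_(i < n) `|tnth e i - tnth a i| ^+ 2 <=
          \sum_(i < n) `|tnth b i - tnth a i| ^+ 2 /\
        (\sum_(i < n) `|tnth e i - tnth a i| ^+ 2 =
           \sum_(i < n) `|tnth b i - tnth a i| ^+ 2 <-> b = e)].
Proof.
move=> G e.
have Gp : posdefmx G := gram_posdef ip a_indep.
have distE (b : n.-tuple H) : \sum_(i < n) `|tnth b i - tnth a i| ^+ 2 =
    \sum_(i < n) ip (tnth b i - tnth a i) (tnth b i - tnth a i).
  by apply: eq_bigr => i _.
have trE : \sum_(i < n) `|tnth a i| ^+ 2 = \tr G.
  by apply: eq_bigr => i _; rewrite mxE.
split=> [b b_onb|].
  have [A [Au bE _]] := orthonormal_basis_lcomb b_onb.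
  exists A; split=> // [i|]; first by rewrite bE tnth_lcomb.
  rewrite distE trE bE orthonormal_sum_dnormB; last by rewrite -bE; case: b_onb.
  (* The product [G^T A^T] is the transpose of [A G], whose trace is the cross term. *)
  by rewrite -trmx_mul mxtrace_tr.
split=> //; first exact: posdefmx_tr.
- exact: loewdin_onb.
- by rewrite distE trE sqrtmx_tr// mxtrace_tr; exact: loewdin_dist.
move=> b b_onb; have [le_eb eq_eb] := loewdin_best a_indep b_onb.
rewrite !distE; split=> //.
by split=> [/eqP|->//]; rewrite eq_eb => /eqP.
Qed.
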